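(* Let $\mathcal G$ be a weighted directed graph on $n$ agents with Laplacian matrix $L=(L_{ij})$, and let $h>0$. Consider the multi-agent system with input saturation and event-triggered control protocol $$\dot x_i(t)=\mathrm{sat}_h(\hat u_i(t)),\qquad \hat u_i(t)=-\sum_{j=1}^n L_{ij}\,x_j\big(t^j_{k_j(t)}\big),\qquad i=1,\dots,n,\ t\ge 0,$$ with states $x_i(t)\in\mathbb R^p$, where $\{t^j_k\}_{k\ge1}$ is the increasing triggering time sequence of agent $v_j$ and $k_j(t)=\operatorname{argmax}_k\{t^j_k\le t\}$. Suppose that $\mathcal G$ has a directed spanning tree, and that the agents are ordered so that $L$ is written in the Perron–Frobenius (block upper triangular) form $$L=\begin{bmatrix}L^{1,1}&L^{1,2}&\cdots&L^{1,M}\\0&L^{2,2}&\cdots&L^{2,M}\\ \vdots&\vdots&\ddots&\vdots\\0&0&\cdots&L^{M,M}\end{bmatrix},$$ where $L^{m,m}$ is the $n_m\times n_m$ block associated with the $m$-th strongly connected component of $\mathcal G$, $m=1,\dots,M$. Given constants $\alpha_i>0$, $\beta_i>0$ and the first triggering time $t^i_1=0$ for each $i$, let agent $v_i$ determine its triggering times $\{t^i_k\}_{k=2}^\infty$ by $$t^i_{k+1}=\max_{r\ge t^i_k}\Big\{r:\ \|e_i(t)\|^2\le \alpha_i e^{-\beta_i t},\ \forall t\in[t^i_k,r]\Big\},$$ where $e_i(t)=x_i(t^i_k)-x_i(t)$ is the measurement error relative to the latest triggering time $t^i_k$. Then: (i) there is no Zeno behavior, i.e., each agent has only finitely many triggering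 times in any finite time interval; (ii) global consensus is achieved, i.e., for every initial condition $(x_1(0),\dots,x_n(0))\in(\mathbb R^p)^n$, $\lim_{t\to\infty}(x_i(t)-x_j(t))=0$ for all $i,j\in\{1,\dots,n\}$.
   Context: Weighted digraph: $\mathcal G=(\mathcal V,\mathcal E,\mathcal A)$ with agents $\mathcal V=\{v_1,\dots,v_n\}$, links $\mathcal E\subseteq\mathcal V\times\mathcal V$, and weighted adjacency matrix $\mathcal A=(a_{ij})$ with $a_{ij}\ge 0$ and $a_{ii}=0$. One has $(v_i,v_j)\in\mathcal E\iff a_{ij}>0$, and this means there is a directed link from $v_j$ to $v_i$ (agent $v_j$ can send information to $v_i$). Laplacian: $L=D-\mathcal A$ with $D=\mathrm{diag}(\sum_j a_{1j},\dots,\sum_j a_{nj})$; that is, $L_{ij}=-a_{ij}$ for $i\ne j$ and $L_{ii}=\sum_{j}a_{ij}$. Directed spanning tree: $\mathcal G$ has a directed spanning tree if there exists an agent $v_{i_0}$ such that for any other agent $v_j$ there is a directed path from $v_{i_0}$ to $v_j$ (a sequence of distinct agents beginning with $v_{i_0}$ and ending with $v_j$ with a directed link from each agent to the next). The block form above can always be obtained by a proper permutation (relabeling) of the agents. Saturation function: for a constant $h>0$ and scalar $s$, $\mathrm{sat}_h(s)=h$ if $s\ge h$, $\mathrm{sat}_h(s)=s$ if $|s|<h$, $\mathrm{sat}_h(s)=-h$ if $s\le -h$; for vectors it is applied componentwise. $\|\cdot\|$ is the Euclidean norm. The control $\hat u_i$ is piecewise constant: it changes only at triggering times, and states $x_i$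 are continuous in $t$. If the set of $r$ in the triggering rule is unbounded (the inequality holds for all $t\ge t^i_k$), agent $v_i$ has no further triggering times after $t^i_k$. *)

(* Defs.v *)
From mathcomp Require Import all_boot all_order all_algebra.
From mathcomp Require Import all_classical all_reals all_analysis.

Set Implicit Arguments.
Unset Strict Implicit.
Unset Printing Implicit Defensive.

Import Order.TTheory GRing.Theory Num.Theory.
Import numFieldNormedType.Exports.

Local Open Scope classical_set_scope.
Local Open Scope ring_scope.

Section Digraph.
Variables (R : realType) (n : nat).

(* [links i j] is (v_i, v_j) \in E; information then flows from v_j to v_i. *)
Record wdigraph := WDigraph {
  links : rel 'I_n;
  adj : 'M[R]_n;
  adj_ge0 : forall i j, 0 <= adj i j;
  adj_diag : forall i, adj i i = 0;
  linksE : forall i j, links i j = (0 < adj i j)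
}.

Variable G : wdigraph.

Definition laplacian : 'M[R]_n :=
  diag_mx (\row_i \sum_j adj G i j) - adj G.

Definition directed_link : rel 'I_n := fun a b => links G b a.

(* The trivial path makes every agent reachable from itself. *)
Definition reachable (i j : 'I_n) : Prop :=
  exists s : seq 'I_n,
    [/\ path directed_link i s, uniq (i :: s) & last i s = j].

Definition has_spanning_tree : Prop :=
  exists i0, forall j, j != i0 -> reachable i0 j.

Definition strongly_connected (i j : 'I_n) : Prop :=
  reachable i j /\ reachable j i.

(* The agents are numbered block after block, [ns m] of them in block [m];
   [tagnat.sig1] maps a position to the block that contains it. *)
Definition perron_frobenius_form (M : nat) (ns : 'I_M -> nat)
    (hn : n = (\sum_(m < M) ns m)%N) : Prop :=
  [/\ forall m, (0 < ns m)%N,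
      forall m l : 'I_M, (l < m)%N ->
        submxblock (castmx (hn, hn) laplacian) m l = 0
    & forall i j : 'I_n,
        tagnat.sig1 (cast_ord hn i) = tagnat.sig1 (cast_ord hn j) <->
        strongly_connected i j].

End Digraph.

Section Protocol.
Variables (R : realType) (n p : nat).

Definition sat (h s : R) : R :=
  if h <= s then h else if s <= - h then - h else s.

Definition vsat (h : R) (v : 'rV[R]_p) : 'rV[R]_p := map_mx (sat h) v.

(* The library norm on 'rV[R]_p is the max norm. *)
Definition enorm (v : 'rV[R]_p) : R := Num.sqrt (\sum_k v 0 k ^+ 2).

(* A triggering time sequence is a map [tau : nat -> \bar R], indexed from 0;
   the value +oo means that there is no further triggering time. *)
Definition triggering_time (tau : nat -> \bar R) (s : R) : Prop :=
  exists k, tau k = s%:E.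

(* k = argmax_k {tau_k <= s}; no such k exists if infinitely many triggering
   times precede s. *)
Definition latest (tau : nat -> \bar R) (s : R) (k : nat) : Prop :=
  (tau k <= s%:E)%E /\ forall k', (tau k' <= s%:E)%E -> (k' <= k)%N.

(* The sample of index k is the one in use at s or immediately before s. *)
Definition in_force (tau : nat -> \bar R) (s : R) (k : nat) : Prop :=
  (tau k <= s%:E)%E /\ (s%:E <= tau k.+1)%E.

Definition uhat (L : 'M[R]_n) (x : 'I_n -> R -> 'rV[R]_p)
    (t : 'I_n -> nat -> \bar R) (kappa : 'I_n -> nat) (i : 'I_n) : 'rV[R]_p :=
  - \sum_j L i j *: x j (fine (t j (kappa j))).

Definition admissible (alpha beta : R) (y : R -> 'rV[R]_p) (tk : R) : set R :=
  [set r | tk <= r /\ forall s, tk <= s <= r ->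
     enorm (y tk - y s) ^+ 2 <= alpha * expR (- beta * s)].

Definition is_max (S : set R) (r : R) : Prop := S r /\ ubound S r.

Definition hold_after (y : R -> 'rV[R]_p) (r : R) (w : 'rV[R]_p) :
    R -> 'rV[R]_p :=
  fun s => if s <= r then y s else y r + (s - r) *: w.

(* The inequality in the rule concerns the motion of agent i while t^i_k is
   still its latest triggering time.  Past a candidate r = t^i_{k+1}, the error
   with respect to x_i(t^i_k) is therefore that of the motion in which agent i
   keeps its k-th sample, and not that of the actual x_i, whose control has
   been updated at r: the update can turn x_i back towards x_i(t^i_k), so that
   along x_i itself the maximum need not be r.  Only the motion just after r
   matters for the maximum.  If other agents trigger at r too, the order of
   these simultaneous events is left open: agent i may see, for each of them,
   the sample before or after its update.
   When no triggering time follows t^i_k, the motion is x_i. *)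
Definition trigger_rule (L : 'M[R]_n) (h : R) (alpha beta : 'I_n -> R)
    (x : 'I_n -> R -> 'rV[R]_p) (t : 'I_n -> nat -> \bar R)
    (i : 'I_n) (k : nat) : Prop :=
  match t i k, t i k.+1 with
  | tk%:E, r%:E =>
      exists kappa : 'I_n -> nat,
        [/\ kappa i = k, forall j, in_force (t j) r (kappa j)
          & is_max (admissible (alpha i) (beta i)
              (hold_after (x i) r (vsat h (uhat L x t kappa i))) tk) r]
  | tk%:E, +oo%E => ~ has_ubound (admissible (alpha i) (beta i) (x i) tk)
  | +oo%E, +oo%E => True
  | _, _ => False
  end.

(* Accumulation of triggering times is not excluded: from an accumulation
   point on, [latest] has no solution and the differential equation imposes
   nothing on x.  The control jumps at triggering times, so the equation is
   required at the other times only; with continuity this determines x. *)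
Record trajectory (L : 'M[R]_n) (h : R) (alpha beta : 'I_n -> R)
    (x0 : 'I_n -> 'rV[R]_p)
    (x : 'I_n -> R -> 'rV[R]_p) (t : 'I_n -> nat -> \bar R) : Prop := {
  traj_init : forall i, x i 0 = x0 i;
  traj_cont : forall i, {within `[0, +oo[, continuous (x i)};
  traj_ode : forall (s : R) (kappa : 'I_n -> nat), 0 <= s ->
    (forall j, ~ triggering_time (t j) s) ->
    (forall j, latest (t j) s (kappa j)) ->
    forall i, is_derive s (1 : R) (x i) (vsat h (uhat L x t kappa i));
  traj_first : forall i, t i 0%N = 0%:E;
  traj_rule : forall i k, trigger_rule L h alpha beta x t i k
}.

Definition no_zeno (tau : nat -> \bar R) : Prop :=
  forall a b : R, finite_set (`[a, b] `&` triggering_time tau).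

Definition consensus (x : 'I_n -> R -> 'rV[R]_p) : Prop :=
  forall i j, x i s - x j s @[s --> +oo] --> (0 : 'rV[R]_p).

End Protocol.

(* Main.v *)
Require Import Defs.
From mathcomp Require Import all_boot all_order all_algebra.
From mathcomp Require Import all_classical all_reals all_analysis.
From mathcomp Require Import lra ring.
Import Order.TTheory GRing.Theory Num.Theory.
Import numFieldNormedType.Exports.
Local Open Scope ring_scope.

Set Implicit Arguments.
Unset Strict Implicit.
Unset Printing Implicit Defensive.

(** Two facts about the protocol carry the theorem.

    There is no accumulation of triggering times because a sample is only
    replaced once the error has reached its threshold ([max_admissible_tight]),
    while saturation bounds the speed of every agent by [h] per coordinate.
    Before a putative first accumulation time [T] the equation of motion is
    available, and the thresholds stay above their value at [T]; so consecutive
    triggering times are separated by a positive constant, and every agent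
    passes [T] after finitely many of them ([no_accumulation]).

    It follows that the equation of motion holds off a locally finite set of
    times and that all sampling errors decay exponentially.  As saturation acts
    on each coordinate, consensus becomes a statement on scalar functions
    [y i] with [y i' = sat h (u i)], where [u i] differs from
    [sum_j a_ij (y j - y i)] by at most [C exp (- b s)] ([saturated_flow]).
    Adding to [y i] the integral [C / b exp (- b s)] of the perturbation still
    to come makes the largest of the [y i] nonincreasing: an agent at the top
    is pulled down by all the others ([max_principle] and
    [flow_max_nonincreasing]).  The same bound from below keeps the [y i]
    bounded, and on a bounded range saturation amounts to multiplying the
    control by a factor bounded away from 0; so the gap between the top and
    [y i] obeys a linear differential inequality ([flow_deficit_derive]).  If
    the root of the spanning tree is below the top by [z] at time [a], that gap
    spreads along the links of the tree, and at a fixed delay later every agent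
    is below the old top by at least [eta z], with a constant [eta > 0]
    ([flow_deficit_propagates]).  The top, being nonincreasing and bounded
    below, falls by less and less; hence the root approaches it.  Since [- y]
    is a flow of the same kind, the root also approaches the bottom, and
    consensus follows ([flow_consensus]). *)

(** * Comparison principles off a finite set of times *)

Lemma within_continuousM (R : realType) (A : set R) (f g : R -> R) :
  {within A, continuous f}%classic -> {within A, continuous g}%classic ->
  {within A, continuous (fun t => f t * g t)}%classic.
Proof. by move=> cf cg t; apply: cvgM; [apply: cf | apply: cg]. Qed.

Lemma within_itvW (R : realType) (f : R -> R) (a b a' b' : R) :
  a <= a' -> b' <= b -> {within `[a, b], continuous f}%classic ->
  {within `[a', b'], continuous f}%classic.
Proof.
move=> aa' bb'; apply: continuous_subspaceW.
by apply: subset_itv; rewrite bnd_simp.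
Qed.

(** If the conclusion failed, the product [(w i t - K) * (b - t)] would have a
    positive maximum over [i] and [t], and at an interior time since the
    product is nonpositive at [a] and zero at [b].  There
    [w i' = (w i - K) / (b - t) > 0], although [w i] is a largest component. *)
Lemma max_principle_smooth (R : realType) (I : finType) (w : I -> R -> R)
    (a b : R) (w_cont : forall i, {within `[a, b], continuous (w i)}%classic)
    (w_der : forall s, a < s < b -> forall i, exists2 d,
       is_derive s 1 (w i) d & (forall j, w j s <= w i s) -> d <= 0) :
  a <= b -> forall K, (forall i, w i a <= K) -> forall i, w i b <= K.
Proof.
rewrite le_eqVlt => /predU1P[<-//|ab] K waK i0; rewrite leNgt; apply/negP => wbK.
pose v i t := (w i t - K) * (b - t).
have v_cont i : {within `[a, b], continuous (v i)}%classic.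
  apply: within_continuousM.
    by apply: within_continuousB => //; apply: continuous_subspaceT => t; apply: cvg_cst.
  apply: continuous_subspaceT => t; apply: cvgB; [exact: cvg_cst|exact: cvg_id].
have [c cP] : exists c : I -> R, forall i, c i \in `[a, b] /\
    forall t, t \in `[a, b] -> v i t <= v i (c i).
  suff /choice[c cP] : forall i, exists c, c \in `[a, b] /\
      forall t, t \in `[a, b] -> v i t <= v i c by exists c.
  by move=> i; have [c cab cmax] := EVT_max (ltW ab) (v_cont i); exists c.
have [i _ imax] := @Order.TotalTheory.arg_maxP _ _ _ i0 xpredT (fun i => v i (c i)) erefl.
have [sab smax] := cP i; move: (c i) sab smax imax => s sab smax imax.
have vmax j t : t \in `[a, b] -> v j t <= v i s.
  by move=> tab; apply: le_trans (imax j isT); have [_] := cP j; apply.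
(* [v] vanishes at [b] but is positive just before it, by continuity *)
have vs_gt0 : 0 < v i s.
  have [t /andP[tab wtK]] : exists t, (a < t < b) && (K < w i0 t).
    have [_ _ +] := (continuous_within_itvP (w i0) ab).1 (w_cont i0).
    move=> /(_ _ (lt_nbhsr wbK)) /= near_b.
    have near_a : (\forall t \near b^'-, a < t)%classic by apply: nbhs_left_gt.
    have near_lt : (\forall t \near b^'-, t < b)%classic by apply: nbhs_left_lt.
    near (b^'-)%classic => t; exists t; apply/andP; split; last by near: t.
    by apply/andP; split; near: t.
  apply: lt_le_trans (vmax i0 t _); last first.
    by rewrite in_itv /=; move/andP: tab => [/ltW-> /ltW->].
  by rewrite mulr_gt0 ?subr_gt0//; case/andP: tab.
have /andP[as_ sb] : a < s < b.
  move: sab; rewrite in_itv /= => /andP[].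
  rewrite [a <= s]le_eqVlt [s <= b]le_eqVlt => /predU1P[sa|as_] /predU1P[sb|sb].
  - by move: vs_gt0; rewrite /v sb subrr mulr0 !ltxx.
  - by move: vs_gt0; rewrite ltNge /v -sa mulr_le0_ge0 ?subr_le0 ?subr_ge0 // ltW.
  - by move: vs_gt0; rewrite /v sb subrr mulr0 !ltxx.
  - by rewrite as_ sb.
have v_der (t d : R) : is_derive t 1 (w i) d ->
    is_derive t 1 (v i) ((w i t - K) * -1 + (b - t) * d).
  move=> wd.
  have := is_deriveM (is_deriveB wd (is_derive_cst K t 1))
                     (is_deriveB (is_derive_cst b t 1) (is_derive_id t 1)).
  by rewrite subr0 sub0r.
have [|d wd dle0] := w_der s _ i; first by rewrite as_ sb.
have vd0 : is_derive s 1 (v i) 0.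
  apply: (@derive1_at_max _ _ a b) => [|t||t].
  - exact: ltW.
  - rewrite in_itv /= => tab.
    by have [e we _] := w_der t tab i; have [] := v_der t e we.
  - by rewrite in_itv /= as_ sb.
  - by move=> tab; apply: vmax; apply: subset_itv_oo_cc tab.
have deq : (w i s - K) * -1 + (b - s) * d = 0.
  by have [_ <-] := vd0; have [_ ->] := v_der s d wd.
have bs0 : 0 < b - s by rewrite subr_gt0.
have wsK : 0 < w i s - K by rewrite -(pmulr_lgt0 _ bs0).
have d_gt0 : 0 < d by nra.
move: d_gt0; rewrite ltNge dle0// => j.
have := vmax j s sab; rewrite /v ler_pM2r // => wj; lra.
Unshelve. all: by end_near. Qed.

(** The conclusion is transitive in the pair of end points, so the interval may
    be cut at the exceptional times. *)
Lemma max_principle (R : realType) (I : finType) (w : I -> R -> R) (a b : R)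
    (F : set R) (F_fin : finite_set (`[a, b] `&` F)%classic)
    (w_cont : forall i, {within `[a, b], continuous (w i)}%classic)
    (w_der : forall s, a < s < b -> ~ F s -> forall i, exists2 d,
       is_derive s 1 (w i) d & (forall j, w j s <= w i s) -> d <= 0) :
  a <= b -> forall K, (forall i, w i a <= K) -> forall i, w i b <= K.
Proof.
have [l lF] := (finite_seqP _).1 F_fin.
have {}w_der s : a < s < b -> s \notin l -> forall i, exists2 d,
    is_derive s 1 (w i) d & (forall j, w j s <= w i s) -> d <= 0.
  move=> sab sl; apply: w_der => // Fs; move/negP: sl; apply.
  suff : [set` l]%classic s by [].
  by rewrite -lF; split => //=; rewrite in_itv /=; case/andP: sab => /ltW-> /ltW->.
elim: l a b w_cont w_der {F_fin lF} => [|c l IH] a b w_cont w_der ab.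
  by apply: max_principle_smooth => // s sab; exact: w_der.
have [/andP[ac cb]|cab] := boolP (a < c < b); last first.
  apply: IH => // s sab sl; apply: w_der => //.
  by rewrite inE (negbTE sl) orbF; apply: contraNneq cab => <-.
move=> K waK; apply: (IH c b) => [i|s /andP[cs sb] sl||].
- exact: within_itvW (ltW ac) _ (w_cont i).
- by apply: w_der; rewrite ?(lt_trans ac cs)// inE gt_eqF.
- exact: ltW.
apply: (IH a c) => // [i|s /andP[as_ sc] sl|].
- exact: within_itvW _ (ltW cb) (w_cont i).
- by apply: w_der; rewrite ?as_ ?(lt_trans sc cb)// inE lt_eqF.
- exact: ltW.
Qed.

Lemma nonincreasing_derive_le0 (R : realType) (f : R -> R) (a b : R)
    (F : set R) (F_fin : finite_set (`[a, b] `&` F)%classic)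
    (f_cont : {within `[a, b], continuous f}%classic)
    (f_der : forall s, a < s < b -> ~ F s ->
       exists2 d, is_derive s 1 f d & d <= 0) :
  a <= b -> f b <= f a.
Proof.
move=> ab; apply: (@max_principle _ unit (fun=> f) a b F) => // s sab Fs _.
by have [d fd d0] := f_der s sab Fs; exists d.
Qed.

Lemma is_derive_mulc (R : realType) (k s : R) :
  is_derive s 1 (fun t => k * t) k.
Proof.
have := is_deriveM (is_derive_cst k s 1) (is_derive_id s 1).
by rewrite scaler0 addr0 /GRing.scale /= mulr1.
Qed.

Lemma bounded_derive_lipschitz (R : realType) (f : R -> R) (a b h : R)
    (F : set R) (F_fin : finite_set (`[a, b] `&` F)%classic)
    (f_cont : {within `[a, b], continuous f}%classic)
    (f_der : forall s, a < s < b -> ~ F s ->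
       exists2 d, is_derive s 1 f d & `|d| <= h) :
  a <= b -> `|f b - f a| <= h * (b - a).
Proof.
move=> ab.
have hcont : {within `[a, b], continuous (fun t : R => h * t)}%classic.
  by apply: continuous_subspaceT => t; apply: cvgM; [exact: cvg_cst|exact: cvg_id].
have up : f b - h * b <= f a - h * a.
  apply: (@nonincreasing_derive_le0 _ (fun t => f t - h * t) a b F) => //.
    exact: within_continuousB.
  move=> s sab Fs; have [d fd dh] := f_der s sab Fs.
  exists (d - h); first by apply: is_deriveB; exact: is_derive_mulc.
  by rewrite subr_le0 (le_trans (ler_norm _) dh).
have down : - f b - h * b <= - f a - h * a.
  apply: (@nonincreasing_derive_le0 _ (fun t => - f t - h * t) a b F) => //.
    by apply: within_continuousB => // t; apply: cvgN; exact: f_cont.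
  move=> s sab Fs; have [d fd dh] := f_der s sab Fs.
  exists (- d - h); last by move: dh; rewrite ler_norml; lra.
  have fdN := is_deriveN fd; have hd := is_derive_mulc h s; exact: is_deriveB.
by rewrite ler_norml; lra.
Qed.

(** * Saturated consensus dynamics with a decaying perturbation *)

Lemma exists_uniform_gt0 (R : realType) (I : finType) (P : I -> R -> Prop) :
  (forall i e e', 0 < e' -> e' <= e -> P i e -> P i e') ->
  (forall i, exists2 e, 0 < e & P i e) -> exists2 e, 0 < e & forall i, P i e.
Proof.
move=> Pdown Pex.
have /choice[e eP] i : exists e, 0 < e /\ P i e.
  by have [e e0 Pe] := Pex i; exists e.
have min_gt0 : 0 < \big[Order.min/1]_i e i.
  by apply: lt_bigmin => // i _; have [] := eP i.
exists (\big[Order.min/1]_i e i) => // i.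
by apply: Pdown (eP i).2 => //; exact: bigmin_le_cond.
Qed.

Lemma is_derive_expRM (R : realType) (k s : R) :
  is_derive s 1 (fun t => expR (k * t)) (k * expR (k * s)).
Proof.
rewrite mulrC; apply: is_derive1_comp (is_derive_expR _) _.
exact: is_derive_mulc.
Qed.

Lemma continuous_expRM (R : realType) (k : R) :
  continuous (fun t => expR (k * t)).
Proof.
move=> t; apply: continuous_comp; last exact: continuous_expR.
by apply: cvgM; [exact: cvg_cst|exact: cvg_id].
Qed.

Lemma sat_norm_le (R : realType) (h u : R) : 0 < h -> `|sat h u| <= h.
Proof.
move=> h0; rewrite /sat ler_norml; case: (leP h u) => hu; first lra.
by case: (leP u (- h)) => uh; lra.
Qed.

Lemma satN (R : realType) (h u : R) : 0 < h -> sat h (- u) = - sat h u.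
Proof.
move=> h0; rewrite /sat.
by case: (leP h u); case: (leP u (- h)); case: (leP h (- u));
  case: (leP (- u) (- h)) => *; lra.
Qed.

Lemma sat_le_ge0 (R : realType) (h u e : R) :
  0 < h -> 0 <= e -> u <= e -> sat h u <= e.
Proof.
move=> h0 e0 ue; rewrite /sat.
by case: (leP h u); case: (leP u (- h)) => *; lra.
Qed.

(** For controls bounded by [U], saturation loses at most the constant factor
    [h / (U + h)]. *)
Lemma sat_le_scale (R : realType) (h U u : R) :
  0 < h -> u < 0 -> `|u| <= U -> sat h u <= h / (U + h) * u.
Proof.
move=> h0 u0; rewrite ltr0_norm// => uU; have Uh : 0 < U + h by lra.
rewrite /sat; case: (leP h u) => hu; first lra.
rewrite mulrAC; case: (leP u (- h)) => uh.
  by rewrite ler_pdivlMr//; nra.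
by rewrite ler_pdivlMr//; nra.
Qed.

(** One coordinate of the agents.  Keeping only a bound on the distance between
    the actual control and the ideal one makes the notion stable under [- y],
    which exchanges largest and smallest agents. *)
Definition saturated_flow (R : realType) (n : nat) (A : 'M[R]_n) (h C b : R)
    (F : set R) (y : 'I_n -> R -> R) : Prop :=
  [/\ forall c d, finite_set (`[c, d] `&` F)%classic,
      forall i, {within `[0, +oo[, continuous (y i)}%classic
    & forall s i, 0 < s -> ~ F s -> exists2 u,
        is_derive s 1 (y i) (sat h u)
        & `|u - \sum_j A i j * (y j s - y i s)| <= C * expR (- b * s)].

(** The integral over [t, +oo[ of the bound [C exp (- b s)] on the
    perturbation. *)
Definition noise_tail (R : realType) (C b t : R) : R := C / b * expR (- b * t).

Lemma noise_tail_ge0 (R : realType) (C b t : R) :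
  0 <= C -> 0 < b -> 0 <= noise_tail C b t.
Proof. by move=> C0 b0; rewrite mulr_ge0 ?expR_ge0// divr_ge0// ltW. Qed.

Lemma is_derive_noise_tail (R : realType) (C b s : R) : 0 < b ->
  is_derive s 1 (noise_tail C b) (- (C * expR (- b * s))).
Proof.
move=> b0.
have := is_deriveM (is_derive_cst (C / b) s 1) (is_derive_expRM (- b) s).
rewrite scaler0 addr0 /GRing.scale /= mulrA mulrN mulNr mulfVK ?gt_eqF//.
Qed.

Lemma saturated_flowN (R : realType) (n : nat) (A : 'M[R]_n) (h C b : R)
    (F : set R) (y : 'I_n -> R -> R) : 0 < h ->
  saturated_flow A h C b F y -> saturated_flow A h C b F (fun i t => - y i t).
Proof.
move=> h0 [F_fin y_cont y_der]; split => // [i t|s i s0 Fs].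
  by apply: cvgN; exact: y_cont.
have [u yd uC] := y_der s i s0 Fs; exists (- u).
  by rewrite satN//; exact: is_deriveN.
have -> : \sum_j A i j * (- y j s - - y i s) = - \sum_j A i j * (y j s - y i s).
  by rewrite -sumrN; apply: eq_bigr => j _; rewrite -mulrN opprB opprK addrC.
by rewrite -opprD normrN.
Qed.

Lemma flow_noise_tail_cont (R : realType) (n : nat) (A : 'M[R]_n) (h C b : R)
    (F : set R) (y : 'I_n -> R -> R) : saturated_flow A h C b F y ->
  forall i a c, 0 <= a ->
  {within `[a, c], continuous (fun t => y i t + noise_tail C b t)}%classic.
Proof.
move=> [_ y_cont _] i a c a0; apply: within_continuousD.
  apply: continuous_subspaceW (y_cont i).
  by apply: subset_itv; rewrite bnd_simp.
apply: continuous_subspaceT => t; apply: cvgM; first exact: cvg_cst.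
exact: continuous_expRM.
Qed.

(** At a largest component every term [a_ij (y j - y i)] is nonpositive, so the
    velocity is at most the perturbation, which the derivative of the tail
    compensates. *)
Lemma flow_max_nonincreasing (R : realType) (n : nat) (A : 'M[R]_n)
    (h C b : R) (F : set R) (y : 'I_n -> R -> R)
    (A_ge0 : forall i j, 0 <= A i j) (h_gt0 : 0 < h) (C_ge0 : 0 <= C)
    (b_gt0 : 0 < b) : saturated_flow A h C b F y ->
  forall a c K, 0 <= a -> a <= c -> (forall i, y i a + noise_tail C b a <= K) ->
  forall i, y i c + noise_tail C b c <= K.
Proof.
move=> flow a c K a0 ac; move: K; have [F_fin y_cont y_der] := flow.
apply: (@max_principle _ _ (fun i t => y i t + noise_tail C b t) a c F) => //.
  by move=> i; exact: flow_noise_tail_cont flow _ _ _ a0.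
move=> s /andP[as_ _] Fs i; have s0 := le_lt_trans a0 as_.
have [u yd uC] := y_der s i s0 Fs.
exists (sat h u - C * expR (- b * s)).
  by apply: is_deriveD => //; exact: is_derive_noise_tail.
move=> imax; rewrite subr_le0; apply: sat_le_ge0 => //.
  by rewrite mulr_ge0 ?expR_ge0.
suff : \sum_j A i j * (y j s - y i s) <= 0 by move: uC; rewrite ler_norml; lra.
apply: sumr_le0 => j _; apply: mulr_ge0_le0 => //.
by rewrite subr_le0; have := imax j; rewrite lerD2r.
Qed.

Lemma flow_bounded (R : realType) (n : nat) (A : 'M[R]_n)
    (h C b : R) (F : set R) (y : 'I_n -> R -> R)
    (A_ge0 : forall i j, 0 <= A i j) (h_gt0 : 0 < h) (C_ge0 : 0 <= C)
    (b_gt0 : 0 < b) : saturated_flow A h C b F y ->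
  exists B, forall s i, 0 <= s -> `|y i s| <= B.
Proof.
move=> flow.
have bound z : saturated_flow A h C b F z ->
    exists B, forall s i, 0 <= s -> z i s <= B.
  move=> zflow; exists (\sum_i `|z i 0 + noise_tail C b 0|) => s i s0.
  have : z i s + noise_tail C b s <= \sum_i `|z i 0 + noise_tail C b 0|.
    apply: (flow_max_nonincreasing A_ge0 h_gt0 C_ge0 b_gt0 zflow (lexx 0)) => // j.
    rewrite (bigD1 j)//= (le_trans (ler_norm _))// lerDl sumr_ge0//.
  by have := noise_tail_ge0 s C_ge0 b_gt0; lra.
have [B1 yB1] := bound _ flow; have [B2 yB2] := bound _ (saturated_flowN h_gt0 flow).
exists (Num.max B1 B2) => s i s0.
rewrite ler_norml le_max yB1// andbT lerNl le_max; apply/orP; right; exact: yB2.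
Qed.

(** For a gap [z i = K - (y i + noise_tail)] below an upper bound [K], the control
    of [i] is at most [S z i - a_ij z j] plus the perturbation, for any one [j]
    and with [S] the total weight.  If it is negative, saturation still
    transmits a fraction [c] of it, as the controls are bounded; the tail
    absorbs the perturbation. *)
Lemma flow_deficit_derive (R : realType) (n : nat) (A : 'M[R]_n)
    (h C b : R) (F : set R) (y : 'I_n -> R -> R)
    (A_ge0 : forall i j, 0 <= A i j) (h_gt0 : 0 < h) (C_ge0 : 0 <= C)
    (b_gt0 : 0 < b) : saturated_flow A h C b F y ->
  exists2 c, 0 < c & forall a K, 0 <= a ->
    (forall i, y i a + noise_tail C b a <= K) ->
    forall s i, a < s -> ~ F s ->
    exists2 d, is_derive s 1 (fun t => K - (y i t + noise_tail C b t)) d &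
      forall j, c * A i j * (K - (y j s + noise_tail C b s)) -
        (1 + \sum_i \sum_j A i j) * (K - (y i s + noise_tail C b s)) <= d.
Proof.
move=> flow; have [_ _ y_der] := flow.
have [B yB] := flow_bounded A_ge0 h_gt0 C_ge0 b_gt0 flow.
set S := \sum_i \sum_j A i j.
have S_ge0 : 0 <= S by apply: sumr_ge0 => i _; exact: sumr_ge0.
have row_le i : \sum_j A i j <= S.
  by rewrite /S [leRHS](bigD1 i)//= lerDl; apply: sumr_ge0 => k _; exact: sumr_ge0.
(* [U] bounds every control, as the [y i] stay within [`|B|] of 0. *)
pose U := S * (2 * `|B|) + C.
have U_ge0 : 0 <= U by rewrite addr_ge0// !mulr_ge0.
pose c := h / (U + h).
have Uh0 : 0 < U + h by lra.
have c_gt0 : 0 < c by rewrite divr_gt0.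
have c_le1 : c <= 1 by rewrite ler_pdivrMr// mul1r; lra.
exists c => // a K a0 yK s i as_ Fs; have s0 := le_lt_trans a0 as_.
have [u yd uC] := y_der s i s0 Fs.
exists (0 - (sat h u - C * expR (- b * s))).
  apply: is_deriveB; apply: is_deriveD => //; exact: is_derive_noise_tail.
move=> j; pose z k := K - (y k s + noise_tail C b s).
rewrite -/(z i) -/(z j).
have z_ge0 k : 0 <= z k.
  by rewrite subr_ge0; exact: (flow_max_nonincreasing A_ge0 _ _ _ flow a0 (ltW as_)).
pose e := C * expR (- b * s); have e_ge0 : 0 <= e by rewrite mulr_ge0 ?expR_ge0.
have e_leC : e <= C.
  by rewrite ler_piMr// -expR0 ler_expR mulNr oppr_le0 mulr_ge0// ltW.
set v := \sum_j A i j * (y j s - y i s) in uC.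
have v_norm : `|v| <= S * (2 * `|B|).
  rewrite (le_trans (ler_norm_sum _ _ _))//.
  apply: le_trans (_ : \sum_j A i j * (2 * `|B|) <= _).
    apply: ler_sum => k _; rewrite normrM (ger0_norm (A_ge0 i k)) ler_wpM2l//.
    have := yB s k (ltW s0); have := yB s i (ltW s0); have := ler_norm B.
    by have := ler_normB (y k s) (y i s); lra.
  by rewrite -mulr_suml ler_wpM2r// mulr_ge0.
have uU : `|u| <= U.
  by move: v_norm uC; rewrite -/e /U !ler_norml; lra.
have v_le : v <= S * z i - A i j * z j.
  have -> : v = \sum_k A i k * (z i - z k).
    by apply: eq_bigr => k _; congr (_ * _); rewrite /z; lra.
  rewrite (bigD1 j)//= mulrBr.
  have : A i j * z i + \sum_(k < n | k != j) A i k * (z i - z k) <= S * z i.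
    apply: le_trans (_ : (\sum_k A i k) * z i <= _); last by rewrite ler_wpM2r.
    rewrite [in leRHS](bigD1 j)//= mulrDl lerD2l mulr_suml; apply: ler_sum => k _.
    by rewrite ler_wpM2l// gerBl.
  lra.
have Azj0 : 0 <= A i j * z j by rewrite mulr_ge0.
have Szi0 : 0 <= S * z i by rewrite mulr_ge0.
have zi0 := z_ge0 i.
have u_le : u <= S * z i - A i j * z j + e by move: uC; rewrite -/e ler_norml; lra.
have cA : c * A i j * z j <= A i j * z j by rewrite -mulrA ler_piMl.
suff : sat h u <= S * z i - c * A i j * z j + e by rewrite -/e; lra.
have [u0|u0] := leP 0 u.
  apply: le_trans (sat_le_ge0 h_gt0 u0 (lexx u)) _; lra.
apply: le_trans (sat_le_scale h_gt0 u0 uU) _; rewrite -/c.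
have cu : c * u <= c * (S * z i - A i j * z j + e) by rewrite ler_wpM2l// ltW.
have cSz : c * (S * z i) <= S * z i by rewrite ler_piMl.
have ce : c * e <= e by rewrite ler_piMl.
by rewrite -mulrA; lra.
Qed.

(** The integrating factor [exp (k t)] turns the inequality into a monotonicity
    statement: the excess of [f] over the equilibrium [q / k] decays no faster
    than [exp (- k t)]. *)
Lemma linear_differential_inequality (R : realType) (f : R -> R)
    (a b k q : R) (F : set R) (k_gt0 : 0 < k)
    (F_fin : finite_set (`[a, b] `&` F)%classic)
    (f_cont : {within `[a, b], continuous f}%classic)
    (f_der : forall s, a < s < b -> ~ F s ->
       exists2 d, is_derive s 1 f d & q - k * f s <= d) :
  a <= b -> q / k + expR (- (k * (b - a))) * (f a - q / k) <= f b.
Proof.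
move=> ab; pose g t := expR (k * t) * (q / k - f t).
have gab : g b <= g a.
  apply: (@nonincreasing_derive_le0 _ g a b F) => //.
    apply: within_continuousM.
      by apply: continuous_subspaceT; exact: continuous_expRM.
    by apply: within_continuousB => //; apply: continuous_subspaceT => t; exact: cvg_cst.
  move=> s sab Fs; have [d fd dq] := f_der s sab Fs.
  exists (expR (k * s) * (q - k * f s - d)).
    have := is_deriveM (is_derive_expRM k s) (is_deriveB (is_derive_cst (q / k) s 1) fd).
    move=> gd; apply: (is_derive_eq gd).
    rewrite /GRing.scale /= -[(cst _ - f) s]/(q / k - f s).
    by field; rewrite gt_eqF.
  by rewrite mulr_ge0_le0 ?expR_ge0// subr_le0.
have eb : expR (k * b) = expR (k * a) * expR (k * (b - a)).
  by rewrite -expRD; congr expR; ring.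
move: gab; rewrite /g eb -mulrA ler_pM2l ?expR_gt0//.
rewrite expRN mulrC -ler_pdivlMr ?expR_gt0//; lra.
Qed.

(** The gap of the root decays at most exponentially.  If [i] has a gap of at
    least [eta z] on [a + m, a + T] and [j] listens to [i], the differential
    inequality for [j] has a source proportional to [eta z], so that after one
    more unit of time [j] too has a gap proportional to [z].  The horizon [T]
    stays arbitrary so that it can be chosen at the end, beyond the delays [m]
    of all the agents. *)
Lemma flow_deficit_propagates (R : realType) (n : nat) (G : wdigraph R n)
    (h C b : R) (F : set R) (y : 'I_n -> R -> R) (h_gt0 : 0 < h)
    (C_ge0 : 0 <= C) (b_gt0 : 0 < b) (r i : 'I_n) :
  saturated_flow (adj G) h C b F y -> reachable G r i ->
  exists2 m : R, 0 <= m & forall T, exists2 eta, 0 < eta &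
    forall a K, 0 <= a -> (forall j, y j a + noise_tail C b a <= K) ->
    forall s, a + m <= s <= a + T ->
    eta * (K - (y r a + noise_tail C b a)) <= K - (y i s + noise_tail C b s).
Proof.
move=> flow [l [+ _ <-]] {i}; have [F_fin _ _] := flow.
have A_ge0 := adj_ge0 G.
have [c c_gt0 deficit] := flow_deficit_derive A_ge0 h_gt0 C_ge0 b_gt0 flow.
set k := 1 + \sum_i \sum_j adj G i j in deficit.
have k_gt0 : 0 < k.
  by rewrite ltr_pwDl// sumr_ge0// => i _; exact: sumr_ge0.
have deficit_ge0 a K : 0 <= a -> (forall j, y j a + noise_tail C b a <= K) ->
    forall s i, a <= s -> 0 <= K - (y i s + noise_tail C b s).
  move=> a0 yK s i as_; rewrite subr_ge0.
  exact: (flow_max_nonincreasing A_ge0 _ _ _ flow a0 as_).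
have deficit_cont i K a s : 0 <= a ->
    {within `[a, s], continuous (fun t => K - (y i t + noise_tail C b t))}%classic.
  move=> a0; apply: within_continuousB; last exact: flow_noise_tail_cont flow _ _ _ a0.
  by apply: continuous_subspaceT => t; exact: cvg_cst.
pose reached i := exists2 m : R, 0 <= m & forall T, exists2 eta, 0 < eta &
    forall a K, 0 <= a -> (forall j, y j a + noise_tail C b a <= K) ->
    forall s, a + m <= s <= a + T ->
    eta * (K - (y r a + noise_tail C b a)) <= K - (y i s + noise_tail C b s).
have reached_step i j : reached i -> directed_link G i j -> reached j.
  rewrite /directed_link linksE => -[m m0 im] Aji; exists (m + 1); first lra.
  move=> T; have [eta eta0 ieta] := im T.
  (* The value at time 1 of the solution of [z' = 1 - k z] that starts at 0. *)
  pose gain := (1 - expR (- k)) / k.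
  have gain0 : 0 < gain by rewrite divr_gt0// subr_gt0 -expR0 ltr_expR; lra.
  exists (c * adj G j i * eta * gain); first by do 3!apply: mulr_gt0 => //.
  move=> a K a0 yK s /andP[as_ sT].
  set zr := K - (y r a + noise_tail C b a).
  have zr0 : 0 <= zr by exact: (deficit_ge0 a K a0 yK a r).
  pose q := c * adj G j i * (eta * zr).
  have q0 : 0 <= q by do 3?apply: mulr_ge0 => //; apply: ltW.
  have zj0 : 0 <= K - (y j (a + m) + noise_tail C b (a + m)).
    by apply: (deficit_ge0 a) => //; lra.
  have := @linear_differential_inequality _ (fun t => K - (y j t + noise_tail C b t))
    (a + m) s k q F k_gt0 (F_fin _ _) (deficit_cont j K (a + m) s (addr_ge0 a0 m0)).
  have zder t : a + m < t < s -> ~ F t -> exists2 d,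
      is_derive t 1 (fun t => K - (y j t + noise_tail C b t)) d &
      q - k * (K - (y j t + noise_tail C b t)) <= d.
    move=> /andP[amt ts] Ft.
    have [|d zd /(_ i) dge] := deficit a K a0 yK t j _ Ft; first lra.
    exists d => //; apply: le_trans dge; rewrite lerD2r /q ler_wpM2l//.
      by rewrite mulr_ge0// ltW.
    by apply: ieta => //; apply/andP; split; lra.
  have ams : a + m <= s by lra.
  move=> /(_ zder ams); apply: le_trans.
  have ek : expR (- (k * (s - (a + m)))) <= expR (- k).
    by rewrite ler_expR lerN2 ler_pMr//; lra.
  have qk0 : 0 <= q / k by rewrite divr_ge0// ltW.
  have -> : c * adj G j i * eta * gain * zr = q / k - expR (- k) * (q / k).
    by rewrite /gain /q; field; rewrite gt_eqF.
  have := ler_wpM2r qk0 ek.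
  rewrite [X in _ -> _ <= _ + X]mulrBr.
  have : 0 <= expR (- (k * (s - (a + m)))) * (K - (y j (a + m) + noise_tail C b (a + m))).
    by rewrite mulr_ge0 ?expR_ge0.
  lra.
have reached_root : reached r.
  exists 0 => // T; exists (expR (- (k * T))); first exact: expR_gt0.
  move=> a K a0 yK s /andP[as_ sT].
  have zr0 : 0 <= K - (y r a + noise_tail C b a) by exact: (deficit_ge0 a K a0 yK a r).
  have := @linear_differential_inequality _ (fun t => K - (y r t + noise_tail C b t))
    a s k 0 F k_gt0 (F_fin _ _) (deficit_cont r K a s a0).
  have zder t : a < t < s -> ~ F t -> exists2 d,
      is_derive t 1 (fun t => K - (y r t + noise_tail C b t)) d &
      0 - k * (K - (y r t + noise_tail C b t)) <= d.
    move=> /andP[amt ts] Ft.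
    have [d zd /(_ r) dge] := deficit a K a0 yK t r amt Ft.
    exists d => //; apply: le_trans dge.
    by rewrite adj_diag mulr0 mul0r.
  have {}as_ : a <= s by lra.
  move=> /(_ zder as_); apply: le_trans.
  rewrite mul0r add0r subr0 ler_wpM2r// ler_expR lerN2 ler_wpM2l ?(ltW k_gt0)//; lra.
have reached_path s j : path (directed_link G) j s -> reached j -> reached (last j s).
  by elim: s j => //= j' s IH j /andP[jj' /IH{}IH] /reached_step/(_ jj').
by move=> rl; exact: reached_path rl reached_root.
Qed.

(** With [top] the largest [y i + noise_tail], propagation gives
    [eta * (top s - root s) <= top s - top (s + T)], and the right-hand side
    tends to 0 because [top] is nonincreasing and bounded below. *)
Lemma flow_below_root (R : realType) (n : nat) (G : wdigraph R n)
    (h C b : R) (F : set R) (y : 'I_n -> R -> R) (h_gt0 : 0 < h)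
    (C_ge0 : 0 <= C) (b_gt0 : 0 < b) (r : 'I_n) :
  saturated_flow (adj G) h C b F y -> (forall i, reachable G r i) ->
  forall e, 0 < e ->
  exists2 a0, 0 <= a0 & forall s, a0 <= s -> forall i, y i s <= y r s + e.
Proof.
move=> flow r_root e e0; have A_ge0 := adj_ge0 G.
pose w i t := y i t + noise_tail C b t.
pose top t := \big[Order.max/w r t]_i w i t.
have w_le_top t i : w i t <= top t by exact: le_bigmax.
have top_le t K : (forall i, w i t <= K) -> top t <= K.
  by move=> wK; apply/bigmax_leP; split.
have [B yB] := flow_bounded A_ge0 h_gt0 C_ge0 b_gt0 flow.
have [T T0 [eta eta0 etaP]] : exists2 T, 0 <= T & exists2 eta, 0 < eta &
    forall i a, 0 <= a -> eta * (top a - w r a) <= top a - w i (a + T).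
  have /choice[m mP] i : exists m : R, 0 <= m /\
      forall T, exists2 eta, 0 < eta & forall a K, 0 <= a ->
      (forall j, w j a <= K) -> forall s, a + m <= s <= a + T ->
      eta * (K - w r a) <= K - w i s.
    have [m m0 mT] := flow_deficit_propagates h_gt0 C_ge0 b_gt0 flow (r_root i).
    by exists m.
  (* The sum of the delays is a horizon common to all the agents. *)
  exists (\sum_i m i); first by apply: sumr_ge0 => i _; have [] := mP i.
  apply: exists_uniform_gt0 => [i eta eta' eta'0 eta'_le etaP a a0|i].
    apply: le_trans (etaP a a0); rewrite ler_wpM2r// subr_ge0; exact: w_le_top.
  have [_ /(_ (\sum_i m i))[eta eta0 etaP]] := mP i; exists eta => // a a0.
  apply: etaP => //; rewrite lexx andbT lerD2l (bigD1 i)//= lerDl.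
  by apply: sumr_ge0 => j _; have [] := mP j.
pose tops := [set top t | t in `[0, +oo[]%classic.
have tops_inf : has_inf tops.
  split; first by exists (top 0), 0 => //=; rewrite in_itv /= lexx.
  exists (- B) => _ [t /= + <-]; rewrite in_itv /= andbT => t0.
  apply: le_trans (w_le_top t r); have := yB t r t0.
  by have := noise_tail_ge0 t C_ge0 b_gt0; rewrite /w ler_norml; lra.
have [_ [a0 /= + <-]] := inf_adherent (mulr_gt0 eta0 e0) tops_inf.
rewrite in_itv /= andbT => a0_ge0 top_a0; exists a0 => // s a0s i.
have s0 : 0 <= s := le_trans a0_ge0 a0s.
have top_s : top s <= top a0.
  apply: top_le => j.
  apply: (flow_max_nonincreasing A_ge0 h_gt0 C_ge0 b_gt0 flow a0_ge0 a0s) => k.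
  exact: w_le_top.
have top_sT : inf tops <= top (s + T).
  by apply: ge_inf; [case: tops_inf | exists (s + T) => //=; rewrite in_itv /= addr_ge0].
have drop : eta * (top s - w r s) <= top s - top (s + T).
  rewrite lerBrDr -lerBrDl; apply: top_le => j.
  by rewrite lerBrDl -lerBrDr; exact: etaP.
have : top s - w r s < e by rewrite -(ltr_pM2l eta0); lra.
by have := w_le_top s i; rewrite /w; lra.
Qed.

Lemma flow_consensus (R : realType) (n : nat) (G : wdigraph R n)
    (h C b : R) (F : set R) (y : 'I_n -> R -> R) (h_gt0 : 0 < h)
    (C_ge0 : 0 <= C) (b_gt0 : 0 < b) :
  has_spanning_tree G -> saturated_flow (adj G) h C b F y ->
  forall e, 0 < e -> exists a0, forall s, a0 <= s ->
  forall i j, `|y i s - y j s| <= e.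
Proof.
move=> [r r_tree] flow e e0.
have r_root i : reachable G r i.
  by have [->|/r_tree//] := eqVneq i r; exists [::].
have e2 : 0 < e / 2 by rewrite divr_gt0.
have [a1 _ below] := flow_below_root h_gt0 C_ge0 b_gt0 flow r_root e2.
have [a2 _ above] :=
  flow_below_root h_gt0 C_ge0 b_gt0 (saturated_flowN h_gt0 flow) r_root e2.
exists (Num.max a1 a2) => s; rewrite ge_max => /andP[a1s a2s] i j.
have := below s a1s i; have := below s a1s j.
have := above s a2s i; have := above s a2s j.
by rewrite ler_norml; lra.
Qed.

(** * Triggering times *)

Lemma sqr_enorm (R : realType) (p : nat) (v : 'rV[R]_p) :
  enorm v ^+ 2 = \sum_k v 0 k ^+ 2.
Proof. by rewrite sqr_sqrtr// sumr_ge0// => k _; exact: sqr_ge0. Qed.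

Lemma enorm_coord_le (R : realType) (p : nat) (v : 'rV[R]_p) (q : 'I_p) :
  `|v 0 q| <= enorm v.
Proof.
rewrite -(ler_pXn2r (n := 2))// ?nnegrE ?sqrtr_ge0// sqr_enorm real_normK ?num_real//.
by rewrite (bigD1 q)//= lerDl sumr_ge0// => k _; exact: sqr_ge0.
Qed.

Lemma is_derive_coord (R : realType) (p : nat) (X : R -> 'rV[R]_p) (s : R)
    (v : 'rV[R]_p) (q : 'I_p) :
  is_derive s 1 X v -> is_derive s 1 (fun t => X t 0 q) (v 0 q).
Proof.
move=> [Xder <-]; have /derivable_mxP/(_ 0 q) Xqder := Xder.
by split => //; rewrite derive_mx// mxE.
Qed.

(** By continuity of the held motion at [r], an error strictly below the
    threshold at [r] would leave room beyond [r]. *)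
Lemma max_admissible_tight (R : realType) (p : nat) (y : R -> 'rV[R]_p)
    (w : 'rV[R]_p) (alpha beta tk r : R) :
  is_max (admissible alpha beta (hold_after y r w) tk) r ->
  [/\ tk <= r,
      forall s, tk <= s <= r -> enorm (y tk - y s) ^+ 2 <= alpha * expR (- beta * s)
    & alpha * expR (- beta * r) <= enorm (y tk - y r) ^+ 2].
Proof.
move=> [[tkr adm] rmax].
have held s : s <= r -> hold_after y r w s = y s by rewrite /hold_after => ->.
have {}adm s : tk <= s <= r ->
    enorm (y tk - y s) ^+ 2 <= alpha * expR (- beta * s).
  by move=> tsr; have := adm s tsr; rewrite !held//; case/andP: tsr.
split => //; rewrite leNgt; apply/negP => slack.
pose gap s := enorm (y tk - (y r + (s - r) *: w)) ^+ 2 - alpha * expR (- beta * s).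
have gap_cont : (gap s @[s --> r] --> gap r)%classic.
  apply: cvgB.
    rewrite (_ : (fun s => _) = fun s =>
        \sum_k (y tk 0 k - (y r 0 k + (s - r) * w 0 k)) ^+ 2).
      rewrite sqr_enorm; apply: cvg_big => [|k _]; first exact: add_continuous.
      rewrite !mxE; apply: cvgM; apply: cvgB; try exact: cvg_cst;
      apply: cvgD; try exact: cvg_cst; apply: cvgM; try exact: cvg_cst;
      apply: cvgB; try exact: cvg_cst; exact: cvg_id.
    by apply/funext => s; rewrite sqr_enorm; apply: eq_bigr => k _; rewrite !mxE.
  by apply: cvgM; [exact: cvg_cst | exact: continuous_expRM].
have gap_lt0 : gap r < 0 by rewrite /gap subrr scale0r addr0 subr_lt0.
have := cvgr_lt _ gap_cont _ gap_lt0.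
rewrite -nbhs_ballE => -[d /= d0 gap_neg].
suff /rmax : admissible alpha beta (hold_after y r w) tk (r + d / 2) by lra.
split; first lra.
move=> s /andP[tks sr]; rewrite (held tk)//.
have [{}sr|rs] := leP s r; first by rewrite held// adm// tks.
rewrite /hold_after (lt_geF rs) -subr_le0; apply/ltW/gap_neg.
by rewrite /ball /= ltr0_norm; lra.
Qed.

Lemma triggers_finite (R : realType) (n : nat) (t : 'I_n -> nat -> \bar R)
    (c d : R) : (forall j k k', (k <= k')%N -> (t j k <= t j k')%E) ->
  (forall j, exists k, (d%:E < t j k)%E) ->
  finite_set (`[c, d] `&` [set s | exists j, triggering_time (t j) s])%classic.
Proof.
move=> t_mono /choice[K dK].
apply: (@sub_finite_set _ _
  (\bigcup_(j in [set: 'I_n]) ((fun k => fine (t j k)) @` `I_(K j)))%classic).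
  move=> s [/= + [j [k tjk]]]; rewrite in_itv /= => /andP[_ sd].
  exists j => //; exists k; last by rewrite tjk.
  rewrite /= ltnNge; apply/negP => Kk.
  have := lt_le_trans (dK j) (t_mono j _ _ Kk).
  by rewrite tjk lte_fin ltNge sd.
apply: bigcup_finite => [|j _]; first exact: finite_finset.
exact/finite_image/finite_II.
Qed.

Lemma trigger_interval (R : realType) (n p : nat) (L : 'M[R]_n) (h : R)
    (alpha beta : 'I_n -> R) (x0 : 'I_n -> 'rV[R]_p)
    (x : 'I_n -> R -> 'rV[R]_p) (t : 'I_n -> nat -> \bar R) (i : 'I_n)
    (k : nat) (tk r : R) :
  trajectory L h alpha beta x0 x t -> t i k = tk%:E -> t i k.+1 = r%:E ->
  [/\ tk <= r,
      forall s, tk <= s <= r ->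
        enorm (x i tk - x i s) ^+ 2 <= alpha i * expR (- beta i * s)
    & alpha i * expR (- beta i * r) <= enorm (x i tk - x i r) ^+ 2].
Proof.
move=> xt tik tik1; have := traj_rule xt i k.
by rewrite /trigger_rule tik tik1 => -[kappa [_ _ /max_admissible_tight]].
Qed.

(** The error vanishes at the triggering time itself, where the threshold is
    positive. *)
Lemma trigger_time_lt (R : realType) (n p : nat) (L : 'M[R]_n) (h : R)
    (alpha beta : 'I_n -> R) (alpha_gt0 : forall i, 0 < alpha i)
    (x0 : 'I_n -> 'rV[R]_p) (x : 'I_n -> R -> 'rV[R]_p)
    (t : 'I_n -> nat -> \bar R) (i : 'I_n) (k : nat) (tk : R) :
  trajectory L h alpha beta x0 x t ->
  t i k = tk%:E -> (tk%:E < t i k.+1)%E.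
Proof.
move=> xt tik; have := traj_rule xt i k; rewrite /trigger_rule tik.
case tik1 : (t i k.+1) => [r| |]//; rewrite ?ltry// => _.
have [tkr _ tight] := trigger_interval xt tik tik1.
rewrite lte_fin lt_neqAle tkr andbT; apply: contraTneq tight => ->.
rewrite subrr sqr_enorm big1 => [|q _]; last by rewrite mxE expr0n.
by rewrite -ltNge mulr_gt0 ?expR_gt0.
Qed.

Lemma trigger_times_mono (R : realType) (n p : nat) (L : 'M[R]_n) (h : R)
    (alpha beta : 'I_n -> R) (alpha_gt0 : forall i, 0 < alpha i)
    (x0 : 'I_n -> 'rV[R]_p) (x : 'I_n -> R -> 'rV[R]_p)
    (t : 'I_n -> nat -> \bar R) :
  trajectory L h alpha beta x0 x t ->
  forall i k k', (k <= k')%N -> (t i k <= t i k')%E.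
Proof.
move=> xt i; apply: (@homo_leq _ (t i) (fun u v => u <= v)%E) => [u //|v u w|k].
  exact: le_trans.
have := traj_rule xt i k; rewrite /trigger_rule.
case tik : (t i k) => [tk| |]//; first by
  move=> _; exact/ltW/(trigger_time_lt alpha_gt0 xt).
by case: (t i k.+1).
Qed.

Lemma trigger_times_ge0 (R : realType) (n p : nat) (L : 'M[R]_n) (h : R)
    (alpha beta : 'I_n -> R) (alpha_gt0 : forall i, 0 < alpha i)
    (x0 : 'I_n -> 'rV[R]_p) (x : 'I_n -> R -> 'rV[R]_p)
    (t : 'I_n -> nat -> \bar R) :
  trajectory L h alpha beta x0 x t -> forall i k, (0 <= t i k)%E.
Proof.
move=> xt i k; have := trigger_times_mono alpha_gt0 xt i (leq0n k).
by rewrite (traj_first xt).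
Qed.

Lemma latest_exists (R : realType) (n p : nat) (L : 'M[R]_n) (h : R)
    (alpha beta : 'I_n -> R) (alpha_gt0 : forall i, 0 < alpha i)
    (x0 : 'I_n -> 'rV[R]_p) (x : 'I_n -> R -> 'rV[R]_p)
    (t : 'I_n -> nat -> \bar R) (i : 'I_n) (s : R) :
  trajectory L h alpha beta x0 x t -> 0 <= s ->
  (exists k, (s%:E < t i k)%E) -> exists k, latest (t i) s k.
Proof.
move=> xt s0 later; case: (ex_minnP later) => -[|k] sk kmin.
  by move: sk; rewrite (traj_first xt) lte_fin ltNge s0.
exists k; split.
  by rewrite leNgt; apply/negP => /kmin; rewrite ltnn.
move=> k'; apply: contraLR; rewrite -!ltNge -ltnNge => kk'.
exact: lt_le_trans sk (trigger_times_mono alpha_gt0 xt _ kk').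
Qed.

(** Until the next triggering time the error is controlled by the rule for
    that time; if there is none, by the unboundedness of the admissible set. *)
Lemma sample_error_le (R : realType) (n p : nat) (L : 'M[R]_n) (h : R)
    (alpha beta : 'I_n -> R) (alpha_gt0 : forall i, 0 < alpha i)
    (x0 : 'I_n -> 'rV[R]_p) (x : 'I_n -> R -> 'rV[R]_p)
    (t : 'I_n -> nat -> \bar R) (i : 'I_n) (s : R) (k : nat) :
  trajectory L h alpha beta x0 x t -> latest (t i) s k ->
  enorm (x i (fine (t i k)) - x i s) ^+ 2 <= alpha i * expR (- beta i * s).
Proof.
move=> xt [ks kmax]; have := traj_rule xt i k; have := trigger_times_ge0 alpha_gt0 xt i k.
rewrite /trigger_rule.
case tik : (t i k) ks => [tk| |]//; rewrite lee_fin => tks _.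
have : (s%:E < t i k.+1)%E.
  by rewrite ltNge; apply/negP => /kmax; rewrite ltnn.
case tik1 : (t i k.+1) => [r| |]//.
  rewrite lte_fin => sr _; have [_ err _] := trigger_interval xt tik tik1.
  by apply: err; rewrite tks ltW.
move=> _ unbounded /=; have [r [[_ adm] sr]] : exists r,
    admissible (alpha i) (beta i) (x i) tk r /\ s < r.
  apply: contrapT => none; apply: unbounded; exists s => r adm.
  by rewrite leNgt; apply/negP => sr; apply: none; exists r.
by apply: adm; rewrite tks ltW.
Qed.

Lemma trajectory_derive (R : realType) (n p : nat) (L : 'M[R]_n) (h : R)
    (alpha beta : 'I_n -> R) (alpha_gt0 : forall i, 0 < alpha i)
    (x0 : 'I_n -> 'rV[R]_p) (x : 'I_n -> R -> 'rV[R]_p)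
    (t : 'I_n -> nat -> \bar R) (s : R) :
  trajectory L h alpha beta x0 x t -> 0 <= s ->
  (forall j, exists k, (s%:E < t j k)%E) ->
  ~ (exists j, triggering_time (t j) s) ->
  exists2 kappa : 'I_n -> nat, forall j, latest (t j) s (kappa j) &
    forall i q, is_derive s 1 (fun r => x i r 0 q) (sat h (uhat L x t kappa i 0 q)).
Proof.
move=> xt s0 later no_trigger.
have /choice[kappa kappaP] j : exists k, latest (t j) s k.
  exact (latest_exists alpha_gt0 xt s0 (later j)).
exists kappa => // i q.
have no_trigger_j j : ~ triggering_time (t j) s by move=> ?; apply: no_trigger; exists j.
have := is_derive_coord q (traj_ode xt s0 no_trigger_j kappaP i).
by rewrite mxE.
Qed.

Lemma trajectory_coord_cont (R : realType) (n p : nat) (L : 'M[R]_n) (h : R)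
    (alpha beta : 'I_n -> R) (x0 : 'I_n -> 'rV[R]_p)
    (x : 'I_n -> R -> 'rV[R]_p) (t : 'I_n -> nat -> \bar R) (i : 'I_n)
    (q : 'I_p) (xt : trajectory L h alpha beta x0 x t) :
  {within `[0, +oo[, continuous (fun s => x i s 0 q)}%classic.
Proof.
move=> s; apply: (@cvg_comp _ _ _ (x i) (fun v : 'rV[R]_p => v 0 q)).
  exact: traj_cont xt _ _.
exact: coord_continuous.
Qed.
Arguments trajectory_coord_cont {R n p L h alpha beta x0 x t} i q xt.

Lemma trajectory_speed (R : realType) (n p : nat) (L : 'M[R]_n) (h : R)
    (h_gt0 : 0 < h)
    (alpha beta : 'I_n -> R) (alpha_gt0 : forall i, 0 < alpha i)
    (x0 : 'I_n -> 'rV[R]_p) (x : 'I_n -> R -> 'rV[R]_p)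
    (t : 'I_n -> nat -> \bar R) (a c : R) :
  trajectory L h alpha beta x0 x t -> 0 <= a -> a <= c ->
  (forall j, exists k, (c%:E < t j k)%E) ->
  forall i, enorm (x i a - x i c) ^+ 2 <= p%:R * (h * (c - a)) ^+ 2.
Proof.
move=> xt a0 ac later i.
have coord q : `|x i c 0 q - x i a 0 q| <= h * (c - a).
  apply: (@bounded_derive_lipschitz _ (fun s => x i s 0 q) a c h
    [set s | exists j, triggering_time (t j) s]%classic) => //.
  - exact: triggers_finite (trigger_times_mono alpha_gt0 xt) later.
  - apply: (continuous_subspaceW _ (trajectory_coord_cont i q xt)).
    by apply: subset_itv; rewrite bnd_simp.
  move=> s /andP[as_ sc] no_trigger.
  have [||kappa _ /(_ i q) xd] := trajectory_derive alpha_gt0 xt _ _ no_trigger.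
  - lra.
  - move=> j; have [k ck] := later j; exists k.
    by apply: lt_trans ck; rewrite lte_fin.
  - by exists (sat h (uhat L x t kappa i 0 q)) => //; exact: sat_norm_le.
rewrite sqr_enorm; apply: le_trans (_ : \sum_(q < p) (h * (c - a)) ^+ 2 <= _).
  apply: ler_sum => q _; rewrite -[leLHS]real_normK ?num_real//.
  rewrite ler_pXn2r ?nnegrE ?mulr_ge0 ?subr_ge0 ?(ltW h_gt0)//.
  by rewrite !mxE distrC.
by rewrite sumr_const card_ord mulr_natl.
Qed.

(** Let [T] be the supremum of the times that every agent passes after finitely
    many triggers.  If agent [j] never reached [T], then between two of its
    triggers at distance [dt <= T] it would move by at least its threshold at
    [T]; with [X] the square of that threshold,
    [X <= p h^2 dt^2 <= (p h^2 T + 1) dt], so that its triggering times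
    would be separated by a positive constant.  So each agent reaches [T], and
    passes it strictly at the next trigger, which contradicts the choice of
    [T]. *)
Lemma no_accumulation (R : realType) (n p : nat) (L : 'M[R]_n) (h : R)
    (h_gt0 : 0 < h) (alpha beta : 'I_n -> R)
    (alpha_gt0 : forall i, 0 < alpha i) (beta_gt0 : forall i, 0 < beta i)
    (x0 : 'I_n -> 'rV[R]_p) (x : 'I_n -> R -> 'rV[R]_p)
    (t : 'I_n -> nat -> \bar R) :
  trajectory L h alpha beta x0 x t ->
  forall s j, exists k, (s%:E < t j k)%E.
Proof.
move=> xt s1; apply: contrapT => unreached.
pose S := [set s : R | 0 <= s /\ forall j, exists k, (s%:E < t j k)%E]%classic.
have S0 : S 0.
  by split => // j; exists 1%N; exact (trigger_time_lt alpha_gt0 xt (traj_first xt j)).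
have S_down s s' : 0 <= s' -> s' <= s -> S s -> S s'.
  move=> s'0 s's [_ later]; split => // j; have [k sk] := later j.
  by exists k; apply: le_lt_trans sk; rewrite lee_fin.
have S_ub : has_ubound S.
  exists s1 => s Ss; rewrite leNgt; apply/negP => s1s; apply: unreached => j.
  have [_ /(_ j)[k sk]] := Ss; exists k; apply: lt_trans sk; by rewrite lte_fin.
have S_sup : has_sup S by split => //; exists 0.
pose T := sup S.
have T0 : 0 <= T by exact: ub_le_sup.
have S_ltT s : 0 <= s -> s < T -> S s.
  move=> s0 sT; have Ts : 0 < T - s by rewrite subr_gt0.
  have [e Se] := sup_adherent Ts S_sup; rewrite subKr => se.
  exact: S_down (ltW se) Se.
have reach_T j : exists k, (T%:E <= t j k)%E.
  apply: contrapT => /forallNP below.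
  have {}below k : (t j k < T%:E)%E by rewrite ltNge; apply/negP/below.
  pose tau k := fine (t j k).
  have tauE k : t j k = (tau k)%:E.
    rewrite fineK// fin_real// (lt_le_trans _ (trigger_times_ge0 alpha_gt0 xt j k))//=.
    exact: lt_trans (below k) (ltry _).
  have tau_ge0 k : 0 <= tau k.
    by have := trigger_times_ge0 alpha_gt0 xt j k; rewrite tauE lee_fin.
  have tau_lt k : tau k < T by rewrite -lte_fin -tauE.
  pose X := alpha j * expR (- beta j * T).
  have X0 : 0 < X by rewrite mulr_gt0 ?expR_gt0.
  (* A displacement over a time [dt <= T] has square at most [D dt]. *)
  pose D := p%:R * h ^+ 2 * T.
  have D0 : 0 <= D by rewrite mulr_ge0// mulr_ge0// sqr_ge0.
  have gap k : X / (D + 1) <= tau k.+1 - tau k.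
    have [tt _ tight] := trigger_interval xt (tauE k) (tauE k.+1).
    have [_ later] := S_ltT _ (tau_ge0 k.+1) (tau_lt k.+1).
    have := trajectory_speed h_gt0 alpha_gt0 xt (tau_ge0 k) tt later j.
    have XT : X <= alpha j * expR (- beta j * tau k.+1).
      rewrite ler_pM2l// ler_expR ler_wnM2l ?oppr_le0 1?ltW//.
    set dt := tau k.+1 - tau k; have dt0 : 0 <= dt by rewrite subr_ge0.
    move=> /(le_trans tight)/(le_trans XT) Xdt.
    have dtT : dt <= T by rewrite /dt; have := tau_ge0 k; have := tau_lt k.+1; lra.
    rewrite ler_pdivrMr; last lra.
    apply: (le_trans Xdt); have -> : p%:R * (h * dt) ^+ 2 = p%:R * h ^+ 2 * dt * dt.
      by ring.
    have : p%:R * h ^+ 2 * dt <= D by rewrite ler_wpM2l// mulr_ge0// sqr_ge0.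
    by move=> /(ler_wpM2r dt0); lra.
  have D1 : 0 < D + 1 by lra.
  have c0 : 0 < X / (D + 1) by rewrite divr_gt0.
  have tau_lin k : k%:R * (X / (D + 1)) <= tau k.
    elim: k => [|k IH]; first by rewrite mul0r.
    by rewrite -natr1 mulrDl mul1r; have := gap k; lra.
  have : 0 <= T / (X / (D + 1)) by rewrite divr_ge0// ltW.
  move=> /archi_boundP; rewrite ltr_pdivrMr// => Tk.
  have := tau_lin (Num.bound (T / (X / (D + 1)))).
  by have := tau_lt (Num.bound (T / (X / (D + 1)))); lra.
have [e e0 Te] : exists2 e : R, 0 < e & forall j, exists k, ((T + e)%:E < t j k)%E.
  apply: (@exists_uniform_gt0 _ _ (fun j e => exists k, ((T + e)%:E < t j k)%E)).
    move=> j e e' _ e'e [k ek]; exists k; apply: le_lt_trans ek.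
    by rewrite lee_fin lerD2l.
  move=> j; have [k Tk] : exists k, (T%:E < t j k)%E.
    have [k] := reach_T j; rewrite le_eqVlt => /predU1P[Tk|]; last by exists k.
    by exists k.+1; exact (trigger_time_lt alpha_gt0 xt (esym Tk)).
  case tjk : (t j k) Tk => [r| |]// Tr; last first.
    by exists 1 => //; exists k; rewrite tjk ltry.
  rewrite lte_fin in Tr; exists ((r - T) / 2); first by rewrite divr_gt0// subr_gt0.
  by exists k; rewrite tjk lte_fin; lra.
have : S (T + e) by split => //; lra.
by move=> /(ub_le_sup S_ub); rewrite -/T; lra.
Qed.

(** * From the protocol to the scalar dynamics *)

Lemma laplacian_sum (R : realType) (n : nat) (G : wdigraph R n) (v : 'I_n -> R)
    (i : 'I_n) :
  \sum_j laplacian G i j * v j = - \sum_j adj G i j * (v j - v i).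
Proof.
have -> : \sum_j adj G i j * (v j - v i) =
    \sum_j adj G i j * v j - (\sum_j adj G i j) * v i.
  by rewrite mulr_suml -sumrB; apply: eq_bigr => j _; rewrite mulrBr.
have -> : \sum_j laplacian G i j * v j =
    \sum_j ((\sum_k adj G i k) *+ (i == j) * v j - adj G i j * v j).
  by apply: eq_bigr => j _; rewrite /laplacian !mxE mulrBl.
rewrite sumrB opprB; congr (_ - _); move: (\sum_k adj G i k) => S.
rewrite (bigD1 i)//= eqxx mulr1n big1 ?addr0// => j ji.
by rewrite eq_sym (negbTE ji) mulr0n mul0r.
Qed.

(** The perturbation of the control of [i] is [sum_j L_ij e_j], where the rule
    bounds [e_j] by [sqrt alpha_j exp (- beta_j s / 2)]. *)
Lemma trajectory_flow (R : realType) (n p : nat) (G : wdigraph R n) (h : R)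
    (h_gt0 : 0 < h) (alpha beta : 'I_n -> R)
    (alpha_gt0 : forall i, 0 < alpha i) (beta_gt0 : forall i, 0 < beta i)
    (x0 : 'I_n -> 'rV[R]_p) (x : 'I_n -> R -> 'rV[R]_p)
    (t : 'I_n -> nat -> \bar R) :
  trajectory (laplacian G) h alpha beta x0 x t ->
  exists C b, [/\ 0 <= C, 0 < b & forall q, saturated_flow (adj G) h C b
    [set s | exists j, triggering_time (t j) s]%classic (fun i s => x i s 0 q)].
Proof.
move=> xt; have later := no_accumulation h_gt0 alpha_gt0 beta_gt0 xt.
have [b b0 b_le] : exists2 b : R, 0 < b & forall j, b <= beta j / 2.
  apply: (@exists_uniform_gt0 _ _ (fun j b => b <= beta j / 2)) => [j b b' _|j].
    exact: le_trans.
  by exists (beta j / 2) => //; rewrite divr_gt0.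
pose C := \sum_i \sum_j `|laplacian G i j| * Num.sqrt (alpha j).
have C_term_ge0 i j : 0 <= `|laplacian G i j| * Num.sqrt (alpha j).
  by rewrite mulr_ge0 ?sqrtr_ge0.
have C0 : 0 <= C by apply: sumr_ge0 => i _; exact: sumr_ge0.
exists C, b; split => // q; split => [c d|i|s i s0 no_trigger].
- exact (triggers_finite c (trigger_times_mono alpha_gt0 xt) (later d)).
- exact (trajectory_coord_cont i q xt).
have [kappa kappaP xder] :=
  trajectory_derive alpha_gt0 xt (ltW s0) (later s) no_trigger.
exists (uhat (laplacian G) x t kappa i 0 q); first exact: xder.
pose e j := x j (fine (t j (kappa j))) - x j s.
have -> : uhat (laplacian G) x t kappa i 0 q
    - \sum_j adj G i j * (x j s 0 q - x i s 0 q) = - \sum_j laplacian G i j * e j 0 q.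
  have := laplacian_sum G (fun j => x j s 0 q) i => /eqP; rewrite -eqr_oppLR => /eqP <-.
  rewrite opprK /uhat mxE summxE addrC -opprB -sumrB; congr (- _).
  by apply: eq_bigr => j _; rewrite !mxE mulrBr.
rewrite normrN (le_trans (ler_norm_sum _ _ _))//.
have e_le j : `|e j 0 q| <= Num.sqrt (alpha j) * expR (- b * s).
  apply: le_trans (enorm_coord_le _ _) _.
  apply: le_trans (_ : Num.sqrt (alpha j) * expR (- (beta j / 2) * s) <= _).
    rewrite -(ler_pXn2r (n := 2))// ?nnegrE ?mulr_ge0 ?sqrtr_ge0 ?expR_ge0//.
    rewrite exprMn (sqr_sqrtr (ltW (alpha_gt0 j))) [expR _ ^+ 2]expr2 -expRD.
    rewrite (_ : - (beta j / 2) * s + _ = - beta j * s); last lra.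
    exact (sample_error_le alpha_gt0 xt (kappaP j)).
  by rewrite ler_wpM2l ?sqrtr_ge0// ler_expR ler_wpM2r ?(ltW s0)// lerN2.
apply: le_trans
  (_ : (\sum_j `|laplacian G i j| * Num.sqrt (alpha j)) * expR (- b * s) <= _).
  rewrite mulr_suml; apply: ler_sum => j _.
  by rewrite normrM -mulrA ler_wpM2l.
rewrite ler_wpM2r ?expR_ge0// /C [leRHS](bigD1 i)//= lerDl.
by apply: sumr_ge0 => k _; exact: sumr_ge0.
Qed.

Unset Implicit Arguments.

Theorem theorem4 (R : realType) (n p : nat) (G : wdigraph R n) (h : R)
    (h_gt0 : 0 < h)
    (Gtree : has_spanning_tree G)
    (M : nat) (ns : 'I_M -> nat) (hn : n = (\sum_(m < M) ns m)%N)
    (GPF : perron_frobenius_form G hn)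
    (alpha beta : 'I_n -> R)
    (alpha_gt0 : forall i, 0 < alpha i) (beta_gt0 : forall i, 0 < beta i)
    (x0 : 'I_n -> 'rV[R]_p)
    (x : 'I_n -> R -> 'rV[R]_p) (t : 'I_n -> nat -> \bar R)
    (xt : trajectory (laplacian G) h alpha beta x0 x t) :
  (forall i, no_zeno (t i)) /\ consensus x.
Proof.
have [C [b [C0 b0 flow]]] := trajectory_flow h_gt0 alpha_gt0 beta_gt0 xt.
split=> [i c d|i j].
  have later := no_accumulation h_gt0 alpha_gt0 beta_gt0 xt d.
  apply: sub_finite_set
    (triggers_finite c (trigger_times_mono alpha_gt0 xt) later).
  by move=> s [cds ts]; split => //; exists i.
apply/cvgrPdist_le => e e0.
have /choice[a aP] q : exists a, forall s, a <= s -> `|x i s 0 q - x j s 0 q| <= e.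
  have [a close] := flow_consensus h_gt0 C0 b0 Gtree (flow q) e0.
  by exists a => s /close.
near=> s; rewrite sub0r normrN /Num.norm /= mx_normrE.
apply: bigmax_le => [|[k q] _]; first exact: ltW.
rewrite ord1 !mxE; apply: aP; apply: le_trans (_ : \sum_q `|a q| <= s); last first.
  by near: s; apply: nbhs_pinfty_ge; rewrite num_real.
rewrite (bigD1 q)//= (le_trans (ler_norm _))// lerDl sumr_ge0//.
Unshelve. all: by end_near. Qed.
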